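(* Let $H$ be a $3$-uniform, regular hypergraph with $|V(H)|=n$. Then $\rho(H)\le \frac{n}{2}$.
   Context: A hypergraph $H=(V,E)$ consists of a non-empty finite set $V=V(H)$ of vertices and a family $E=E(H)$ of subsets of $V$ called edges; all edges are non-empty and every vertex belongs to at least one edge. $H$ is $3$-uniform if $|e|=3$ for every $e\in E$. The degree of a vertex $v$ is $|\{e\in E: v\in e\}|$, and $H$ is regular if all vertices have the same degree. An edge cover in $H$ is a subfamily $E'\subseteq E$ with $\bigcup E'=V$, and $\rho(H)$ is the minimum of $|E'|$ over all edge covers $E'$. *)

(* Defs.v *)
From mathcomp Require Import all_boot all_order all_algebra.

Set Implicit Arguments.
Unset Strict Implicit.
Unset Printing Implicit Defensive.

(* A family of subsets is a set of subsets: there are no repeated edges.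
   Since the edges lie in V, [edges_cover] says exactly that every vertex
   belongs to at least one edge. *)
Record hypergraph (V : finType) := Hypergraph {
  edges : {set {set V}};
  vertices_neq0 : 0 < #|V|;
  edges_neq0 : set0 \notin edges;
  edges_cover : cover edges = [set: V]
}.

Section HypergraphDefs.

Variables (V : finType) (H : hypergraph V).

Definition uniform (k : nat) : Prop := forall e, e \in edges H -> #|e| = k.

Definition degree (v : V) : nat := #|[set e in edges H | v \in e]|.

Definition regular : Prop := forall u v : V, degree u = degree v.

Definition edge_cover (C : {set {set V}}) : bool :=
  (C \subset edges H) && (cover C == [set: V]).

Lemma edge_cover_edges : edge_cover (edges H).
Proof. by rewrite /edge_cover subxx edges_cover eqxx. Qed.

(* The default [edges H] of [arg min] is itself an edge cover, so this is
   the genuine minimum; see [rhoP]. *)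
Definition rho : nat :=
  #|[arg min_(C < edges H | edge_cover C) #|C|]|.

Lemma rhoP :
  (exists2 C, edge_cover C & #|C| = rho) /\
  (forall C, edge_cover C -> rho <= #|C|).
Proof.
rewrite /rho; case: arg_minnP => [|C coverC minC]; first exact: edge_cover_edges.
by split=> //; exists C.
Qed.

End HypergraphDefs.

(* Main.v *)
Require Import Defs.
From mathcomp Require Import all_boot all_order all_algebra.
From mathcomp Require Import zify lra.

Set Implicit Arguments.
Unset Strict Implicit.
Unset Printing Implicit Defensive.

Import Order.TTheory GRing.Theory Num.Theory.
Local Open Scope ring_scope.

(* The proof bounds covers by fractional ones.  Call a nonempty subset of an edge
   a face, and let z be a weighting of faces with total weight 1 at every vertex
   of U.  Then U has a cover by at most sum z + #|U| / 6 edges; a d-regular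
   3-uniform hypergraph has the weighting z = 1/d on edges, with sum z = n / 3,
   whence n / 3 + n / 6 = n / 2.

   The bound is proved by induction on #|U|.  A vertex of the polytope of all z
   has at most #|U| faces in its support.  If a nonempty R can be covered by k
   edges and the faces inside R have total weight at least k - #|R| / 6, delete R
   from U and from all faces.  If no such R exists, counting the incidences of
   the support shows that it is a 3-regular family of triples.  For such a
   family, take a maximal set of disjoint triples, then a suitable maximum
   matching among the traces on the remaining vertices: counting traces shows
   that there are at most as many unmatched vertices as triples. *)

(** * Covers, faces and fractional partitions *)

Section Covers.

Variables (V : finType) (E : {set {set V}}).
Implicit Types (U R e : {set V}) (z : {set V} -> rat).

(** The empty set counts as a face once [E] is non-empty; [fpart_supp] keeps it out of supports. *)
Definition face e := [exists f in E, e \subset f].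

Definition coverable U k :=
  exists C : {set {set V}}, [/\ C \subset E, U \subset cover C & (#|C| <= k)%N].

Lemma face_sub e e' : e' \subset e -> face e -> face e'.
Proof.
move=> e'e /existsP[f /andP[fE ef]]; apply/existsP; exists f.
by rewrite fE (subset_trans e'e).
Qed.

Lemma coverable_face e : face e -> coverable e 1.
Proof.
move=> /existsP[f /andP[fE ef]]; exists [set f].
by rewrite sub1set fE /cover big_set1 ef cards1.
Qed.

Lemma coverableU U U' k k' :
  coverable U k -> coverable U' k' -> coverable (U :|: U') (k + k').
Proof.
move=> [C [CE UC Ck]] [C' [CE' UC' Ck']]; exists (C :|: C').
rewrite subUset CE CE' /cover bigcup_setU setUSS //; split=> //.
by rewrite (leq_trans _ (leq_add Ck Ck')) // cardsU leq_subr.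
Qed.

Lemma coverable_sub U U' k k' :
  U' \subset U -> (k <= k')%N -> coverable U k -> coverable U' k'.
Proof.
move=> sU kk [C [CE UC Ck]]; exists C.
by split=> //; [exact: subset_trans sU UC | exact: leq_trans Ck kk].
Qed.

Record fractional_partition U z : Prop := FractionalPartition {
  fpart_ge0 : forall e, 0 <= z e;
  fpart_supp : forall e, z e != 0 -> [/\ e != set0, e \subset U & face e];
  fpart_sum : forall v, v \in U -> \sum_(e : {set V} | v \in e) z e = 1
}.

Definition supp z := [set e | z e != 0].

Definition weight z R := \sum_(e : {set V} | e \subset R) z e.

Lemma weight_ge z U R (s : seq {set V}) : fractional_partition U z ->
  uniq s -> all (fun e => e \subset R) s -> \sum_(e <- s) z e <= weight z R.
Proof.
move=> zP us /allP sR; rewrite -big_filter big_uniq ?filter_uniq //=.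
rewrite /weight (bigID [in s] (fun e => e \subset R)) /=.
rewrite -[X in X <= _]addr0 lerD ?sumr_ge0 // => [|e _]; last exact: (fpart_ge0 zP).
rewrite le_eqVlt; apply/orP; left; apply/eqP; apply: eq_bigl => e.
by rewrite mem_filter andTb; case: (boolP (e \in s)) => [/sR ->|]; rewrite ?andbF.
Qed.

(** Double counting of weighted incidences: a supporting face is counted once at each of its [k]
    vertices. *)
Lemma fpart_uniform_total U z k : fractional_partition U z ->
  (forall e, z e != 0 -> #|e| = k) -> k%:R * (\sum_(e : {set V}) z e) = #|U|%:R.
Proof.
move=> zP zk; rewrite -sum1_card natr_sum -(eq_bigr _ (fpart_sum zP)).
rewrite (exchange_big_dep predT) //= mulr_sumr; apply: eq_bigr => e _.
have [->|ze] := eqVneq (z e) 0; first by rewrite mulr0 big1.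
have [_ /subsetP eU _] := fpart_supp zP ze.
rewrite sumr_const -(zk e ze) mulr_natl; congr (_ *+ _); apply: eq_card => v.
by apply/idP/andP => [ve|[]//]; split=> //; exact: eU.
Qed.

(** Each face is replaced by its trace outside [R], and the weights of equal traces are added.
    Vertices outside [R] keep their total, and exactly the weight of the faces inside [R] is lost,
    their trace being empty. *)
Lemma fpart_restrict U z R : fractional_partition U z ->
  exists2 z', fractional_partition (U :\: R) z' &
    \sum_(e : {set V}) z' e = \sum_(e : {set V}) z e - weight z R.
Proof.
move=> zP.
pose z' f := if f == set0 then 0 else \sum_(e : {set V} | e :\: R == f) z e.
have z'E (P : pred {set V}) : ~~ P set0 ->
    \sum_(f | P f) z' f = \sum_(e : {set V} | P (e :\: R)) z e.
  move=> P0; rewrite [RHS](partition_big (fun e => e :\: R) P) //=.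
  apply: eq_bigr => f Pf; rewrite /z'; case: eqP => [f0|_].
    by rewrite f0 (negPf P0) in Pf.
  by apply: eq_bigl => e; case: eqP => [->|]; rewrite ?Pf ?andbF.
exists z'; first split.
- by move=> f; rewrite /z'; case: ifP => // _; apply: sumr_ge0 => e _; exact: (fpart_ge0 zP).
- move=> f; rewrite /z'; case: (eqVneq f set0) => [_|f0 /eqP s0]; first by rewrite eqxx.
  case: (pickP (fun e : {set V} => (e :\: R == f) && (z e != 0))) => [e|none].
    case/andP=> /eqP ef /(fpart_supp zP)[_ eU fe]; split=> //.
    + by rewrite -ef setSD.
    + by rewrite -ef; apply: face_sub fe; apply: subsetDl.
  case: s0; apply: big1 => e ef; move: (none e); rewrite ef /=.
  by move/negbFE/eqP.
- move=> v /setDP[vU vR]; rewrite z'E ?inE // -(fpart_sum zP vU).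
  by apply: eq_bigl => e; rewrite inE vR.
- rewrite (bigD1 set0) //= {1}/z' eqxx add0r (z'E (fun e => e != set0)) ?eqxx //.
  rewrite /weight [in RHS](bigID (fun e => e \subset R) predT) /= addrAC subrr add0r.
  by apply: eq_bigl => e; rewrite setD_eq0.
Qed.

End Covers.

(** * Reduction to small support *)

Section SmallSupport.

Variables (V : finType) (E : {set {set V}}).
Implicit Types (U R e : {set V}) (z : {set V} -> rat).

(** With more rows than columns, the incidence matrix of [S] against [U] has a nonzero row vector in
    its left kernel. *)
Lemma incidence_kernel U (S : {set {set V}}) : (#|U| < #|S|)%N ->
  exists2 h : {set V} -> rat, exists e, h e != 0 &
    (forall e, e \notin S -> h e = 0) /\
    (forall v, v \in U -> \sum_(e : {set V} | v \in e) h e = 0).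
Proof.
move=> ltUS.
pose A := \matrix_(i < #|S|, j < #|U|) ((enum_val j \in enum_val i)%:R : rat).
have /rowV0Pn[u /sub_kermxP uA u0] : kermx A != 0.
  rewrite -mxrank_eq0 mxrank_ker -lt0n subn_gt0.
  exact: leq_ltn_trans (rank_leq_col A) ltUS.
have h_out e : e \notin S -> \sum_(i < #|S| | enum_val i == e) u 0 i = 0.
  move=> eS; apply: big1 => i /eqP ie; by rewrite -ie enum_valP in eS.
(* [enum_val] is injective, so this sum is the coordinate of [e], or 0 outside [S]. *)
exists (fun e => \sum_(i < #|S| | enum_val i == e) u 0 i).
  have [i ui] : exists i, u 0 i != 0.
    apply/existsP; apply: contraNT u0; rewrite negb_exists => /forallP u0.
    by apply/eqP/rowP=> i; rewrite mxE; apply/eqP; have := u0 i; rewrite negbK.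
  exists (enum_val i); rewrite (big_pred1 i) // => j.
  exact: (inj_eq enum_val_inj).
split=> // v vU.
have := congr1 (fun w : 'rV_#|U| => w 0 (enum_rank_in vU v)) uA.
rewrite !mxE => sum0; rewrite -[RHS]sum0 (exchange_big_dep predT) //=.
apply: eq_bigr => i _; rewrite !mxE enum_rankK_in //.
case: (boolP (v \in enum_val i)) => vi; last first.
  by rewrite mulr0; apply: big1 => e /andP[ve /eqP ie]; rewrite ie ve in vi.
rewrite mulr1 (big_pred1 (enum_val i)) // => e /=.
by rewrite eq_sym; case: eqP => [->|]; rewrite ?vi ?andbF.
Qed.

(** Moving [z] along a kernel vector of the incidences of its support keeps every vertex total; the
    move goes in a direction of nonincreasing sum until a coordinate vanishes. *)
Lemma fpart_small_support U z : fractional_partition E U z ->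
  exists z', [/\ fractional_partition E U z',
    \sum_(e : {set V}) z' e <= \sum_(e : {set V}) z e & (#|supp z'| <= #|U|)%N].
Proof.
have [n] := ubnP #|supp z|; elim: n z => // n IHn z; rewrite ltnS => lezn zP.
have [leSU|ltUS] := leqP #|supp z| #|U|; first by exists z.
have [h [hn0 [h_out h_ker] h_sum]] : exists h : {set V} -> rat, [/\ exists e, h e != 0,
    (forall e, e \notin supp z -> h e = 0) /\
    (forall v, v \in U -> \sum_(e : {set V} | v \in e) h e = 0) &
    \sum_(e : {set V}) h e <= 0].
  have [h hn0 [h_out h_ker]] := incidence_kernel ltUS.
  have [le0|lt0] := lerP (\sum_(e : {set V}) h e) 0; first by exists h.
  exists (fun e => - h e); split.
  - by have [e he] := hn0; exists e; rewrite oppr_eq0.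
  - split=> [e /h_out->|v vU]; rewrite ?oppr0 // sumrN h_ker ?oppr0 //.
  - by rewrite sumrN oppr_le0 ltW.
(* If [h] were nonnegative, its zero vertex sums would force it to vanish on the support. *)
have [e0 e0lt] : exists e, h e < 0.
  apply/existsP; apply: contraT; rewrite negb_exists => /forallP hge0.
  have [e he] := hn0.
  have : e \in supp z by apply: contraNT he => /h_out/eqP.
  rewrite inE => /(fpart_supp zP)[/set0Pn[v ve] /subsetP eU _].
  have /eqP := h_ker v (eU v ve).
  rewrite psumr_eq0 => [/allP/(_ e)|e' _]; last by rewrite leNgt hge0.
  by rewrite mem_index_enum ve (negPf he) => /(_ isT).
(* Ratio test: [t] is the longest step keeping [z + t h] nonnegative, and it annihilates the
   coordinate [e1]. *)
have [e1 e1lt e1min] := @arg_minP _ rat _ e0 (fun e => h e < 0) (fun e => z e / - h e) e0lt.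
set t := z e1 / - h e1 in e1min *.
have tge0 : 0 <= t by rewrite divr_ge0 ?(fpart_ge0 zP) // oppr_ge0 ltW.
have [] := IHn (fun e => z e + t * h e).
- apply: leq_trans lezn; apply: proper_card; apply/properP; split.
    apply/subsetP=> e; rewrite !inE; apply: contraNN => /eqP ze.
    by rewrite ze h_out ?mulr0 ?addr0 // inE ze eqxx.
  exists e1; last by rewrite inE negbK /t invrN mulrN mulNr divfK ?subrr // lt_eqF.
  by rewrite inE; apply: contraTN e1lt => /eqP ze; rewrite h_out ?ltxx // inE ze eqxx.
- split.
  + move=> e /=; have [hge|hlt] := lerP 0 (h e).
      by apply: addr_ge0; [exact: (fpart_ge0 zP) | exact: mulr_ge0].
    have := e1min e hlt; rewrite ler_pdivlMr ?oppr_gt0 //; lra.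
  + move=> e ne0; apply: (fpart_supp zP); apply: contraNN ne0 => /eqP ze.
    by rewrite ze h_out ?mulr0 ?addr0 // inE ze eqxx.
  + by move=> v vU; rewrite big_split -mulr_sumr h_ker //= mulr0 addr0 (fpart_sum zP).
move=> z' [z'P lez' cardz']; exists z'; split=> //; apply: le_trans lez' _.
by rewrite big_split -mulr_sumr /= gerDl mulr_ge0_le0.
Qed.

End SmallSupport.

(** * Families of triples with all degrees three *)

Section Cubic.

Variables (V : finType) (E : {set {set V}}).
Implicit Types (U R e p q : {set V}) (M P : {set {set V}}).
Local Open Scope nat_scope.

Lemma coverable_cover P :
  (forall e, e \in P -> face E e) -> coverable E (cover P) #|P|.
Proof.
move=> faceP; pose g e := odflt e [pick f in E | e \subset f].
have gP e : e \in P -> g e \in E /\ e \subset g e.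
  move=> /faceP/existsP[f /andP[fE ef]]; rewrite /g.
  by case: pickP => [f' /andP[]|/(_ f)] //=; rewrite fE ef.
exists (g @: P); split; last exact: leq_imset_card.
  by apply/subsetP=> _ /imsetP[e /gP[gE _] ->].
apply/bigcupsP=> e eP; have [_ eg] := gP e eP.
by rewrite (subset_trans eg) // (bigcup_max (g e)) // imset_f.
Qed.

Lemma sum_card_setI (F : {set {set V}}) (S : {set V}) :
  \sum_(e in F) #|e :&: S| = \sum_(v in S) #|[set e in F | v \in e]|.
Proof.
under eq_bigr => e _ do rewrite -sum1_card.
under [RHS]eq_bigr => v _ do rewrite -sum1_card.
rewrite (exchange_big_dep [in S]) /= => [|e v _]; last by rewrite inE => /andP[].
apply: eq_bigr => v vS; apply: eq_bigl => e.
by rewrite !inE vS andbT.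
Qed.

Lemma card_set_in (T : finType) (F : {set T}) (P : pred T) :
  #|[set e in F | P e]| = \sum_(e in F) P e.
Proof. by rewrite -sum1dep_card big_mkcondr; apply: eq_bigr => e _; case: (P e). Qed.

(** * Maximum-weight matchings among traces *)

Section Matching.

Variables (F : {set {set V}}) (U' : {set V}).
Hypothesis deg3 : forall v, v \in U' -> #|[set e in F | v \in e]| = 3.
Hypothesis trace2 : forall e, e \in F -> #|e :&: U'| <= 2.

Let mult p := #|[set e in F | p \subset e]|.

Definition pairing M :=
  trivIset M && [forall p in M, [&& #|p| == 2, p \subset U' & 0 < mult p]].

(** The constant 3 makes two pairs outweigh one pair of multiplicity at most 1; between matchings
    with equally many pairs, multiplicity decides. *)
Let wt M := \sum_(p in M) (3 + mult p).

Lemma pairingP M p : pairing M -> p \in M -> [/\ #|p| = 2, p \subset U' & 0 < mult p].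
Proof. by case/andP=> _ /forall_inP H /H/and3P[/eqP]. Qed.

Lemma pairing_add M q : pairing M -> #|q| = 2 -> q \subset U' :\: cover M ->
  0 < mult q -> pairing (q |: M) /\ wt (q |: M) = 3 + mult q + wt M.
Proof.
move=> MP q2 qsub mq; have [trM /forall_inP allM] := andP MP.
have /andP[qU dqM] : (q \subset U') && [disjoint q & cover M].
  by rewrite -subsetD.
have [|||tr' qM] := @trivIsetU1 _ q M.
- by move=> p pM; apply: disjointWr dqM; exact: bigcup_sup.
- exact: trM.
- by apply/negP => /allM/and3P[]; rewrite cards0.
split; last by rewrite /wt big_setU1.
rewrite /pairing tr'; apply/forall_inP => p /setU1P[->|/allM //].
by rewrite q2 qU mq.
Qed.

Lemma pairing_del M p : pairing M -> p \in M ->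
  [/\ pairing (M :\ p), wt M = 3 + mult p + wt (M :\ p) &
      U' :\: cover (M :\ p) = (U' :\: cover M) :|: p].
Proof.
move=> MP pM; have [trM /forall_inP allM] := andP MP; split.
- rewrite /pairing (trivIsetS (subsetDl _ _)) //.
  by apply/forall_inP => q /setD1P[_ /allM].
- by rewrite /wt (big_setD1 p).
- have [_ pU _] := pairingP MP pM.
  apply/setP=> v; rewrite !inE; have [vp|vp] := boolP (v \in p).
    rewrite orbT (subsetP pU) // andbT; apply/bigcupP => -[q /setD1P[qp qM] vq].
    by rewrite -(def_pblock trM qM vq) (def_pblock trM pM vp) eqxx in qp.
  rewrite orbF; congr (~~ _ && _); apply/bigcupP/bigcupP => -[q].
    by case/setD1P=> _ qM vq; exists q.
  by move=> qM vq; exists q => //; rewrite !inE qM andbT; apply: contraNneq vp => <-.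
Qed.

Variable M : {set {set V}}.
Hypothesis MP : pairing M.
Hypothesis Mmax : forall M', pairing M' -> wt M' <= wt M.

Let W := U' :\: cover M.

Lemma mult_pair e p : e \in F -> p \subset e -> 0 < mult p.
Proof. by move=> eF pe; apply/card_gt0P; exists e; rewrite inE eF. Qed.

(** Two unmatched vertices in one member of [F] would form a pair that enlarges [M]. *)
Lemma unmatched_trace e : e \in F -> #|e :&: W| <= 1.
Proof.
move=> eF; rewrite leqNgt; apply/negP => lt1.
have eW2 : #|e :&: W| = 2.
  apply/eqP; rewrite eqn_leq lt1 andbT (leq_trans _ (trace2 eF)) //.
  by rewrite subset_leq_card // setIS // subsetDl.
have [||] := pairing_add MP eW2; first exact: subsetIr.
  exact: mult_pair eF (subsetIl _ _).
by move=> /Mmax + wtE; rewrite wtE; lia.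
Qed.

(** By [unmatched_trace], the traces of these members join a matched vertex to an unmatched one. *)
Let EW := [set e in F | (#|e :&: U'| == 2) && (e :&: W != set0)].

Lemma pair_trace e v w : e \in F -> v \in e -> w \in e -> v \in U' -> w \in U' ->
  v != w -> e :&: U' = [set v; w].
Proof.
move=> eF ve we vU wU vw; apply/esym/eqP; rewrite eqEcard cards2 vw trace2 // andbT.
by apply/subsetP=> x /set2P[]->; rewrite inE ?ve ?we.
Qed.

(* If both ends of a matched pair [{a, b}] see unmatched vertices, these are
   one and the same vertex [w] (otherwise augment), and then [{a, w}] has
   larger multiplicity than [{a, b}]. *)
Lemma matched_end a b (A := [set e in EW | a \in e]) (B := [set e in EW | b \in e]) :
  [set a; b] \in M -> a != b -> 2 <= #|A| -> B = set0.
Proof.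
move=> pM ab A2; apply/eqP; apply: contraT => /set0Pn[eb].
have [_ pU mp] := pairingP MP pM.
have [MP' wtM WE] := pairing_del MP pM.
have aU : a \in U' by rewrite (subsetP pU) // set21.
have bU : b \in U' by rewrite (subsetP pU) // set22.
have aM : a \in cover M by apply/bigcupP; exists [set a; b]; rewrite // set21.
have bM : b \in cover M by apply/bigcupP; exists [set a; b]; rewrite // set22.
have WU : W \subset U' by exact: subsetDl.
have aW w : w \in W -> a != w.
  by move=> /setDP[_ wM]; apply: contraNneq wM => <-.
have bW w : w \in W -> b != w.
  by move=> /setDP[_ wM]; apply: contraNneq wM => <-.
rewrite !inE => /andP[/and3P[ebF _ /set0Pn[w /setIP[web wW]]] beb].
(* At least two of the three members at [a] lie in [A], and none of these contains [b]: its trace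
   would be [{a, b}], without an unmatched vertex. *)
have mult_le3 : mult [set a; b] <= 1.
  have sub : [set e in F | [set a; b] \subset e] \subset [set e in F | a \in e] :\: A.
    apply/subsetP=> e; rewrite !inE subUset !sub1set => /and3P[eF ae be].
    rewrite eF ae /= !andbT; apply/negP => /andP[_ /set0Pn[w' /setIP[we' wW']]].
    have: w' \in e :&: U' by rewrite inE we' (subsetP WU).
    rewrite (pair_trace eF ae be) // !inE.
    by rewrite (eq_sym w' a) (eq_sym w' b) (negPf (aW _ wW')) (negPf (bW _ wW')).
  apply: leq_trans (subset_leq_card sub) _.
  have AD : A \subset [set e in F | a \in e].
    by apply/subsetP=> e; rewrite !inE => /andP[/and3P[-> _ _] ->].
  by rewrite cardsDS // deg3 // leq_subLR addn1 ltnS.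
have sub2 x w' : x \in [set a; b] -> w' \in W ->
    [set x; w'] \subset U' :\: cover (M :\ [set a; b]).
  move=> xp wW'; rewrite WE -/W subUset !sub1set.
  by rewrite !(in_setU _ W) xp wW' orbT.
(* A second unmatched vertex [w'] would allow [{a, w'}] and [{b, w}] to replace [{a, b}], raising
   the weight. *)
have AW e : e \in A -> [set a; w] \subset e.
  rewrite !inE => /andP[/and3P[eF _ /set0Pn[w' /setIP[we' wW']]] ae].
  have [<-|ww'] := eqVneq w' w; first by rewrite subUset !sub1set ae.
  have [|||M1 wt1] := @pairing_add _ [set a; w'] MP'.
  - by rewrite cards2 aW.
  - by rewrite sub2 ?set21.
  - by apply: (mult_pair eF); rewrite subUset !sub1set ae.
  have cE : cover ([set a; w'] |: M :\ [set a; b]) =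
            cover (M :\ [set a; b]) :|: [set a; w'].
    by rewrite /cover bigcup_setU big_set1 setUC.
  have [|||M2 wt2] := @pairing_add _ [set b; w] M1.
  - by rewrite cards2 bW.
  - rewrite cE -setDDl subsetD sub2 ?set22 // disjoint_sym disjoints_subset.
    rewrite subUset !sub1set !inE !negb_or ab aW // (eq_sym w' b) bW //.
  - by apply: (mult_pair ebF); rewrite subUset !sub1set beb.
  have := Mmax M2; rewrite wt2 wt1 wtM; move: mult_le3; clear.
  by move: (mult _) (mult _) (mult _) (wt _) => m1 m2 m3 m4; lia.
have [e0 e0A] : exists e, e \in A by apply/card_gt0P; exact: ltnW.
have e0F : e0 \in F by move: e0A; rewrite !inE => /andP[/and3P[]].
have [|||M1 wt1] := @pairing_add _ [set a; w] MP'.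
- by rewrite cards2 aW.
- by rewrite sub2 ?set21.
- exact: mult_pair e0F (AW _ e0A).
have : #|A| <= mult [set a; w].
  apply: subset_leq_card; apply/subsetP=> e eA; rewrite inE (AW e eA) andbT.
  by move: eA; rewrite !inE => /andP[/and3P[]].
have := Mmax M1; rewrite wt1 wtM; move: mult_le3 A2; clear.
move: #|A| (mult _) (mult _) (wt _) => m1 m2 m3 m4; lia.
Qed.

Lemma pair_notin_EW a b e : [set a; b] \in M -> a != b -> e \in F ->
  [set a; b] \subset e -> e \notin EW.
Proof.
move=> pM ab eF; have [_ pU _] := pairingP MP pM.
rewrite subUset !sub1set => /andP[ae be].
rewrite !inE eF /=; apply/negP => /andP[_ /set0Pn[w /setIP[we wW]]].
have: w \in e :&: U' by rewrite inE we; case/setDP: wW.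
rewrite (pair_trace eF ae be) ?(subsetP pU) ?set21 ?set22 // => wp.
by case/setDP: wW => _ /bigcupP[]; exists [set a; b].
Qed.

Lemma card_cover_pairing : #|cover M| = 2 * #|M|.
Proof.
have [trM _] := andP MP; rewrite -(eqP trM) (eq_bigr (fun=> 2)).
  by rewrite sum_nat_const mulnC.
by move=> p pM; have [] := pairingP MP pM.
Qed.

Lemma card_trace e : #|e :&: U'| = #|e :&: cover M| + #|e :&: W|.
Proof.
have sU : cover M \subset U'.
  by apply/bigcupsP=> p pM; have [] := pairingP MP pM.
by rewrite -(cardsID (cover M) (e :&: U')) -setIA (setIidPr sU) setIDA.
Qed.

(** Charge each member to the matched end of its trace. A pair receives at most two charges: at most
    one at each end, or, by [matched_end], all at one end, where one of the three members contains
    the pair and lies outside [EW]. *)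
Lemma card_EW : #|EW| <= 2 * #|M|.
Proof.
have trM : trivIset M by case/andP: MP.
apply: (@leq_trans (\sum_(e in EW) #|e :&: cover M|)).
  rewrite -sum1_card; apply: leq_sum => e; rewrite inE => /and3P[eF /eqP eU _].
  by have := unmatched_trace eF; have := card_trace e; rewrite eU; lia.
rewrite sum_card_setI /= big_trivIset //= mulnC -sum_nat_const.
apply: leq_sum => p pM; have [/eqP/cards2P[a [b [ab pE]]] pU mp] := pairingP MP pM.
rewrite {}pE in pM pU mp *; rewrite big_setU1 ?inE //= big_set1.
have le2 x : x \in [set a; b] -> #|[set e in EW | x \in e]| <= 2.
  move=> xp; rewrite -ltnS -(deg3 (subsetP pU x xp)); apply: proper_card.
  apply/properP; split.
    by apply/subsetP=> e; rewrite !inE => /andP[/and3P[-> _ _] ->].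
  case/card_gt0P: mp => e; rewrite inE => /andP[eF pe]; exists e.
    by rewrite inE eF (subsetP pe).
  by rewrite inE (negPf (pair_notin_EW pM ab eF pe)).
have [lea|/(matched_end pM ab)->] := leqP #|[set e in EW | a \in e]| 1; last first.
  by rewrite cards0 addn0 le2 ?set21.
have [leb|] := leqP #|[set e in EW | b \in e]| 1; first exact: leq_add lea leb.
rewrite setUC eq_sym in pM ab; move=> /(matched_end pM ab)->.
by rewrite cards0 le2 ?set22.
Qed.

(** Matched vertices have [6 |M|] incidences with [F]. A two-element trace uses two of them, or one
    if its member is in [EW]; [card_EW] then gives the bound. *)
Lemma card_trace2 : #|[set e in F | #|e :&: U'| == 2]| <= 4 * #|M|.
Proof.
suff : 2 * #|[set e in F | #|e :&: U'| == 2]| <= 6 * #|M| + #|EW|.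
  by have := card_EW; lia.
have <- : \sum_(e in F) #|e :&: cover M| = 6 * #|M|.
  rewrite sum_card_setI (eq_bigr (fun=> 3)) ?sum_nat_const ?card_cover_pairing.
    by rewrite mulnC mulnA.
  move=> v /bigcupP[p pM vp]; apply: deg3; have [_ pU _] := pairingP MP pM.
  exact: subsetP pU v vp.
rewrite card_set_in [in leqRHS]card_set_in -big_split /= big_distrr /=.
apply: leq_sum => e eF; case: eqP => //= eU.
have := unmatched_trace eF; have := card_trace e.
by rewrite eU -cards_eq0; case: #|e :&: W| => [|[|]] //=; lia.
Qed.

End Matching.

(** [T] is a maximum family of disjoint triples and [M] a maximum-weight pairing on the rest [U'].
    Counting traces gives [|U| <= 4 |T| + 2 |M|]. One edge per triple, pair and leftover vertex
    makes at most [|U| - 2 |T| - |M| <= |U| / 2] edges. *)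
Lemma cubic_coverable (F : {set {set V}}) (U : {set V}) :
  (forall e, e \in F -> [/\ #|e| = 3, e \subset U & face E e]) ->
  (forall v, v \in U -> #|[set e in F | v \in e]| = 3) ->
  exists2 k, coverable E U k & 2 * k <= #|U|.
Proof.
move=> FP deg3.
pose okT (T : {set {set V}}) := (T \subset F) && trivIset T.
have okT0 : okT set0 by rewrite /okT sub0set; apply/trivIsetP=> ? ?; rewrite inE.
have [T /andP[TF trT] Tmax] := @arg_maxnP _ set0 okT (fun T => #|T|) okT0.
pose U' := U :\: cover T.
have trace2 e : e \in F -> #|e :&: U'| <= 2.
  move=> eF; have [e3 eU _] := FP e eF; rewrite -ltnS -e3.
  apply: proper_card; rewrite properE subsetIl subsetI subxx /=.
  apply/negP; rewrite subsetD => /andP[_ deT].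
  have [|||tr' eT] := @trivIsetU1 _ e T.
  - by move=> p pT; apply: disjointWr deT; exact: bigcup_sup.
  - exact: trT.
  - by apply/negP => /(subsetP TF)/FP[]; rewrite cards0.
  have := Tmax (e |: T); rewrite /okT subUset sub1set eF TF tr' => /(_ isT).
  by rewrite cardsU1 eT /=; lia.
have deg3' v : v \in U' -> #|[set e in F | v \in e]| = 3.
  by move=> /setDP[/deg3].
pose wt (M : {set {set V}}) := \sum_(p in M) (3 + #|[set e in F | p \subset e]|).
have ok0 : pairing F U' set0.
  rewrite /pairing; apply/andP; split; first by apply/trivIsetP=> ? ?; rewrite inE.
  by apply/forall_inP=> p; rewrite inE.
have [M MP Mmax] := @arg_maxnP _ set0 (pairing F U') wt ok0.
have E2le := card_trace2 deg3' trace2 MP Mmax.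
have cardM := card_cover_pairing MP.
have cardT : #|cover T| = 3 * #|T|.
  rewrite -(eqP trT) (eq_bigr (fun=> 3)) ?sum_nat_const 1?mulnC //.
  by move=> e /(subsetP TF)/FP[].
have TU : cover T \subset U by apply/bigcupsP=> e /(subsetP TF)/FP[].
have MU : cover M \subset U' by apply/bigcupsP=> p /(pairingP MP)[].
have cardF : #|F| = #|U|.
  have := sum_card_setI F U; rewrite (eq_bigr (fun=> 3)) => [|e]; last first.
    by case/FP=> e3 /setIidPl->.
  by rewrite [RHS](eq_bigr (fun=> 3)) // !sum_nat_const; lia.
(* Members of [T] leave empty traces; any other trace has at most two vertices, the second being
   counted by the last term. *)
have sumU' : 3 * #|U'| <= #|F :\: T| + #|[set e in F | #|e :&: U'| == 2]|.
  rewrite mulnC -sum_nat_const -(eq_bigr _ deg3') -sum_card_setI.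
  have -> : F :\: T = [set e in F | e \notin T] by apply/setP=> e; rewrite !inE andbC.
  rewrite !card_set_in -big_split /=; apply: leq_sum => e eF.
  case eT: (e \in T) => /=; last by case: eqP (trace2 e eF) => /=; lia.
  suff -> : e :&: U' = set0 by rewrite cards0.
  apply/eqP; rewrite setI_eq0 -setI_eq0 /U' setIDA setD_eq0.
  by rewrite (subset_trans (subsetIl _ _)) // (bigcup_max e).
have cU' : #|U'| = #|U| - #|cover T| by rewrite cardsDS.
have cFT : #|F :\: T| = #|F| - #|T| by rewrite cardsDS.
have cW : #|U' :\: cover M| = #|U'| - #|cover M| by rewrite cardsDS.
have leT := subset_leq_card TU; have leM := subset_leq_card MU.
exists (#|T| + #|M| + #|U' :\: cover M|); last by lia.
have UE : U = cover T :|: cover M :|: (U' :\: cover M).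
  have setUD (A B : {set V}) : A \subset B -> B = A :|: (B :\: A).
    by move=> AB; rewrite -{1}(setID B A) (setIidPr AB).
  by rewrite -setUA -(setUD _ _ MU) -(setUD _ _ TU).
rewrite [X in coverable _ X]UE; apply: coverableU; first apply: coverableU.
- by apply: coverable_cover => e /(subsetP TF)/FP[].
- apply: coverable_cover => p /(pairingP MP)[_ _ /card_gt0P[e]].
  by rewrite inE => /andP[/FP[_ _ fe] pe]; exact: face_sub fe.
- have WE : cover [set [set w] | w in U' :\: cover M] = U' :\: cover M.
    rewrite cover_imset; apply/setP=> v; apply/bigcupP/idP => [[w wW]|vW].
      by rewrite inE => /eqP->.
    by exists v; rewrite // inE.
  rewrite -{1}WE; apply: coverable_sub (subxx _) (leq_imset_card _ _) _.
  apply: coverable_cover => _ /imsetP[w /setDP[/setDP[wU _] _] ->].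
  have /card_gt0P[e] : 0 < #|[set e in F | w \in e]| by rewrite deg3.
  rewrite inE => /andP[/FP[_ _ fe] we].
  by apply: face_sub fe; rewrite sub1set.
Qed.

End Cubic.

(** * Irreducible weightings in rank three *)

Section RankThree.

Variables (V : finType) (E : {set {set V}}).
Hypothesis E_rank : forall e, e \in E -> (#|e| <= 3)%N.
Implicit Types (U R e p : {set V}) (z : {set V} -> rat).

Section Irreducible.

Variables (U : {set V}) (z : {set V} -> rat).
Hypothesis zP : fractional_partition E U z.
Hypothesis z_small : (#|supp z| <= #|U|)%N.
Hypothesis z_irr : forall R k, R \subset U -> R != set0 -> coverable E R k ->
  weight z R < k%:R - #|R|%:R / 6.

Let star v := [set e in supp z | v \in e].

Lemma suppP e : e \in supp z ->
  [/\ e != set0, e \subset U, face E e, (#|e| <= 3)%N & 0 < z e].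
Proof.
rewrite inE => ze; have [e0 eU fe] := fpart_supp zP ze; split=> //.
  have /existsP[f /andP[/E_rank f3 ef]] := fe.
  exact: leq_trans (subset_leq_card ef) f3.
by rewrite lt_neqAle eq_sym ze (fpart_ge0 zP).
Qed.

Lemma weight_face e : e \in supp z -> weight z e < 1 - #|e|%:R / 6.
Proof. by case/suppP=> e0 eU fe _ _; apply: (z_irr (k := 1)) => //; apply: coverable_face. Qed.

Lemma weight_faceU e f : e \in supp z -> f \in supp z ->
  weight z (e :|: f) < 2 - #|e :|: f|%:R / 6.
Proof.
case/suppP=> e0 eU fe _ _ /suppP[_ fU ff _ _]; apply: (z_irr (k := 2)).
- by rewrite subUset eU.
- by rewrite setU_eq0 (negPf e0).
- exact: (coverableU (coverable_face fe) (coverable_face ff)).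
Qed.

Lemma in_star v e : (e \in star v) = (e \in supp z) && (v \in e).
Proof. by rewrite in_set. Qed.

Lemma sum_sub (A B : {set {set V}}) : A \subset B ->
  \sum_(e in A) z e <= \sum_(e in B) z e.
Proof.
move=> AB; rewrite [leRHS](big_setID A) /= (setIidPr AB) lerDl.
by apply: sumr_ge0 => e _; apply: (fpart_ge0 zP).
Qed.

Lemma starP v e : e \in star v -> e \in supp z /\ v \in e.
Proof. by rewrite inE => /andP[]. Qed.

Lemma star_sum v : v \in U -> \sum_(e in star v) z e = 1.
Proof.
move=> vU; rewrite -(fpart_sum zP vU) [RHS](bigID [in supp z]) /=.
rewrite [X in _ + X]big1 ?addr0 => [|e /andP[_]]; last by rewrite inE negbK => /eqP.
by apply: eq_bigl => e; rewrite !inE andbC.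
Qed.

(** A lone face [e] at [v] would have weight 1, above the bound [1 - |e| / 6]. *)
Lemma star_deg v : v \in U -> (2 <= #|star v|)%N.
Proof.
move=> vU; have := star_sum vU; rewrite leqNgt ltnS leq_eqVlt ltnS leqn0 cards_eq0.
move=> sum1; apply/negP => /orP[/cards1P[e se]|/eqP s0]; last first.
  by move: sum1; rewrite s0 big_set0 => /eqP; rewrite eq_sym oner_eq0.
have es : e \in supp z.
  by have : e \in star v by [rewrite se set11]; rewrite inE => /andP[].
have := weight_face es; have := @weight_ge _ _ _ _ e [:: e] zP.
rewrite /= subxx big_seq1 => /(_ isT isT).
by move: sum1; rewrite se big_set1 => ->; have := ler0n rat #|e|; lra.
Qed.

Lemma star_deg2 v p : v \in U -> #|star v| = 2%N -> p \in star v ->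
  exists X, [/\ X != p, star v = [set p; X] & z p + z X = 1].
Proof.
move=> vU /eqP/cards2P[x [y [xy sE]]]; have := star_sum vU; rewrite sE.
rewrite big_setU1 ?inE //= big_set1 => zxy /orP[]/eqP->.
  by exists y; rewrite eq_sym.
by exists x; rewrite setUC addrC.
Qed.

(** Two triples at [v] would each weigh less than [1 - 3/6], too little for a total of 1. *)
Lemma deg2_small v : v \in U -> #|star v| = 2%N ->
  exists2 p, p \in star v & (#|p| <= 2)%N.
Proof.
move=> vU s2; have /card_gt0P[p ps] : (0 < #|star v|)%N by rewrite s2.
have [X [_ sE zX]] := star_deg2 vU s2 ps.
have Xs : X \in star v by rewrite sE set22.
have [|p3] := leqP #|p| 2; first by exists p.
have [|X3] := leqP #|X| 2; first by exists X.
have lt12 e : e \in star v -> (2 < #|e|)%N -> z e < 1 / 2.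
  rewrite inE => /andP[es _] e3; have [_ _ _ le3 _] := suppP es.
  have e3' : #|e| = 3%N by apply/eqP; rewrite eqn_leq le3.
  have := weight_face es; have := @weight_ge _ _ _ _ e [:: e] zP.
  by rewrite /= subxx big_seq1 e3' => /(_ isT isT); lra.
by have := lt12 p ps p3; have := lt12 X Xs X3; lra.
Qed.

Lemma pair_weight a b : a != b -> [set a; b] \in supp z -> z [set a; b] < 2 / 3.
Proof.
move=> ab ps; have := weight_face ps.
have := @weight_ge _ _ _ _ [set a; b] [:: [set a; b]] zP.
have -> : #|[set a; b]| = 2%N by rewrite cards2 ab.
by rewrite /= subxx big_seq1 => /(_ isT isT); lra.
Qed.

(** If one face contained the other, the weight inside it would be at least 1, against
    [weight_face]. *)
Lemma pair_deg2_sub a b X : a != b -> [set a; b] \in supp z -> X \in supp z ->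
  X != [set a; b] -> z [set a; b] + z X = 1 ->
  ~~ (X \subset [set a; b]) /\ ~~ ([set a; b] \subset X).
Proof.
move=> ab ps Xs Xp zpX; split; apply/negP => sub.
  have := weight_face ps; have := @weight_ge _ _ _ _ [set a; b] [:: [set a; b]; X] zP.
  rewrite /= subxx sub inE eq_sym Xp !big_cons big_nil => /(_ isT isT).
  by have := ler0n rat #|[set a; b]|; lra.
have := weight_face Xs; have := @weight_ge _ _ _ _ X [:: [set a; b]; X] zP.
rewrite /= subxx sub inE eq_sym Xp !big_cons big_nil => /(_ isT isT).
by have := ler0n rat #|X|; lra.
Qed.

(* With [X] and [Y] the other faces at [a] and [b], the set [X :|: Y] is
   reducible unless [X = {a, c}] and [Y = {b, c}]; in that case [{a, b, c}]
   together with a further face at [c] is reducible. *)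
Lemma pair_not_deg2 a b : a != b -> [set a; b] \in supp z ->
  #|star a| = 2%N -> #|star b| != 2%N.
Proof.
set p := [set a; b] => ab ps sa; apply/eqP => sb.
have [_ pU fp _ _] := suppP ps.
have aU : a \in U by rewrite (subsetP pU) // set21.
have bU : b \in U by rewrite (subsetP pU) // set22.
have pa : p \in star a by rewrite inE ps set21.
have pb : p \in star b by rewrite inE ps set22.
have [X [Xp saE zX]] := star_deg2 aU sa pa.
have [Y [Yp sbE zY]] := star_deg2 bU sb pb.
have [Xs aX] : X \in supp z /\ a \in X by apply: starP; rewrite saE set22.
have [Ys bY] : Y \in supp z /\ b \in Y by apply: starP; rewrite sbE set22.
have [Xnp pnX] := pair_deg2_sub ab ps Xs Xp zX.
have [Ynp pnY] := pair_deg2_sub ab ps Ys Yp zY.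
have bX : b \notin X by move: pnX; rewrite subUset !sub1set aX.
have aY : a \notin Y by move: pnY; rewrite subUset !sub1set bY andbT.
have XY : X != Y by apply: contraNneq bX => ->.
have zp : z p < 2 / 3 := pair_weight ab ps.
have pXY : p \subset X :|: Y by rewrite subUset !sub1set !inE aX bY orbT.
have wXY : 2 - z p <= weight z (X :|: Y).
  have := @weight_ge _ _ _ _ (X :|: Y) [:: p; X; Y] zP.
  rewrite /= !inE eq_sym (negPf Xp) eq_sym (negPf Yp) XY pXY subsetUl subsetUr.
  by rewrite !big_cons big_nil => /(_ isT isT); lra.
have irrXY := weight_faceU Xs Ys.
(* Comparing [wXY] with [irrXY] gives [|X :|: Y| < 6 z p < 4]. *)
have card3 : (#|X :|: Y| <= 3)%N.
  rewrite leqNgt; apply/negP => gt3.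
  have : (4%:R : rat) <= #|X :|: Y|%:R by rewrite ler_nat.
  by lra.
have [c cX ca] : exists2 c, c \in X & c != a.
  have /subsetPn[c cX cp] := Xnp; exists c => //.
  by apply: contraNneq cp => ->; rewrite set21.
have cb : c != b by apply: contraNneq bX => <-.
have abc3 : #|c |: p| = 3%N by rewrite cardsU1 /p !inE negb_or ca cb cards2 ab.
have XYE : X :|: Y = c |: p.
  by apply/esym/eqP; rewrite eqEcard abc3 card3 subUset sub1set inE cX pXY.
have cY : c \in Y.
  have /subsetPn[y yY yp] := Ynp.
  have : y \in c |: p by rewrite -XYE inE yY orbT.
  by rewrite in_setU1 (negPf yp) orbF => /eqP<-.
have cU : c \in U by case: (suppP Xs) => _ /subsetP->.
have cardXY : (#|X :|: Y|%:R : rat) = 3 by rewrite XYE abc3.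
have pc : c \notin p by rewrite !inE negb_or ca cb.
(* Without such a [Q], the weight inside [X :|: Y] is at least [1 + z p] and at least [2 - z p],
   hence at least [3/2]; but irreducibility of this three-vertex set makes it less than [3/2]. *)
have [Q /starP[Qs cQ] /and3P[QX QY Qc]] :
    exists2 Q, Q \in star c & [&& Q != X, Q != Y & Q != [set c]].
  apply/exists_inP; apply: contraT => /exists_inPn noQ.
  have sub : star c \subset [set X; Y; [set c]].
    apply/subsetP=> Q /noQ; apply: contraR.
    by rewrite !inE !negb_or => /andP[/andP[-> ->] ->].
  have cX1 : [set c] != X.
    by apply: contraTneq aX => <-; rewrite inE eq_sym.
  have cY1 : [set c] != Y.
    by apply: contraTneq bY => <-; rewrite inE eq_sym.
  have cp : [set c] != p.
    by apply: contraNneq pc => <-; rewrite set11.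
  have := sum_sub sub; rewrite star_sum // setUC big_setU1 ?inE ?negb_or ?cX1 //=.
  rewrite big_setU1 ?inE //= big_set1.
  have := @weight_ge _ _ _ _ (X :|: Y) [:: [set c]; p; X; Y] zP.
  rewrite /= !inE !negb_or cX1 cY1 cp eq_sym Xp eq_sym Yp XY pXY subsetUl subsetUr.
  rewrite sub1set inE cX /= !big_cons big_nil => /(_ isT isT).
  by move: irrXY; rewrite cardXY; lra.
have aQ : a \notin Q.
  apply/negP => aQ; have : Q \in star a by rewrite in_star Qs.
  by rewrite saE !inE (negPf QX) orbF => /eqP QE; rewrite -QE cQ in pc.
have bQ : b \notin Q.
  apply/negP => bQ; have : Q \in star b by rewrite in_star Qs.
  by rewrite sbE !inE (negPf QY) orbF => /eqP QE; rewrite -QE cQ in pc.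
have sub : X :|: Y \subset p :|: Q.
  by rewrite XYE subUset sub1set subsetUl !inE cQ orbT.
(* Four vertices bound the weight of [p :|: Q] by [4/3], yet it contains [p], [X] and [Y], of total
   [2 - z p > 4/3]. *)
have gt3 : (4%:R : rat) <= #|p :|: Q|%:R.
  have [d dQ dc] : exists2 d, d \in Q & d != c.
    apply/exists_inP; apply: contraR Qc => /exists_inPn Q1.
    rewrite eqEsubset sub1set cQ andbT; apply/subsetP=> d /Q1.
    by rewrite negbK inE.
  have dp : d \notin c |: p.
    rewrite !inE !negb_or dc /=.
    by apply/andP; split; apply: contraTneq dQ => ->.
  have dcp4 : #|d |: (c |: p)| = 4%N by rewrite (cardsU1 d) dp abc3.
  rewrite ler_nat -dcp4.
  apply: subset_leq_card; rewrite !subUset !sub1set !inE dQ cQ !orbT /=.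
  by rewrite !eqxx !orbT.
have := weight_faceU ps Qs.
have := @weight_ge _ _ _ _ (p :|: Q) [:: p; X; Y] zP.
rewrite /= !inE !negb_or eq_sym Xp eq_sym Yp XY subsetUl.
rewrite (subset_trans (subsetUl _ _) sub) (subset_trans (subsetUr _ _) sub) /=.
by rewrite !big_cons big_nil => /(_ isT isT); lra.
Qed.

(** Let [Y] be the heavier of the two other faces [Y], [Y'] at [b], so that [z Y > 1/6]. With five
    vertices [X :|: Y] would be reducible, so it is [b |: X]. Hence [X :|: Y'] contains [p], [X],
    [Y] and [Y'], of total [2 - z p > 4/3], and with at least four vertices it is reducible. *)
Lemma pair_not_deg3 a b X : a != b -> [set a; b] \in supp z ->
  #|star a| = 2%N -> X \in star a -> #|X| = 3%N -> #|star b| != 3%N.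
Proof.
set p := [set a; b] => ab ps sa Xa X3; apply/eqP => sb3.
have [_ pU _ _ _] := suppP ps.
have aU : a \in U by rewrite (subsetP pU) // set21.
have bU : b \in U by rewrite (subsetP pU) // set22.
have pa : p \in star a by rewrite in_star ps set21.
have pb : p \in star b by rewrite in_star ps set22.
have Xp : X != p by apply: contra_eq_neq X3 => ->; rewrite cards2 ab.
have [Xs aX] := starP Xa.
have [X' [_ saE zX]] := star_deg2 aU sa pa.
have XE : X = X' by apply/eqP; move: Xa; rewrite saE !inE (negPf Xp).
rewrite -{X'}XE in saE zX.
have [_ pnX] := pair_deg2_sub ab ps Xs Xp zX.
have bX : b \notin X by move: pnX; rewrite subUset !sub1set aX.
have zp : z p < 2 / 3 := pair_weight ab ps.
have bX4 : #|b |: X| = 4%N by rewrite cardsU1 bX X3.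
have key Y Y' : Y != Y' -> star b :\ p = [set Y; Y'] -> z Y' <= z Y -> False.
  move=> YY' sb leY.
  have inb Z : Z \in [set Y; Y'] -> [/\ Z != p, Z \in supp z & b \in Z].
    by rewrite -sb => /setD1P[Zp /starP[Zs bZ]].
  have [Yp Ys bY] := inb Y (set21 _ _).
  have [Y'p Y's bY'] := inb Y' (set22 _ _).
  have XY : X != Y by apply: contraNneq bX => ->.
  have XY' : X != Y' by apply: contraNneq bX => ->.
  have zY : z p + z Y + z Y' = 1.
    rewrite -(star_sum bU) (big_setD1 p) //= sb big_setU1 ?inE //= big_set1.
    by rewrite addrA.
  have pX (Z : {set V}) : b \in Z -> p \subset X :|: Z.
    by move=> bZ; rewrite subUset !sub1set !inE aX bZ orbT.
  have bXsub (Z : {set V}) : b \in Z -> b |: X \subset X :|: Z.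
    by move=> bZ; rewrite subUset sub1set inE bZ orbT subsetUl.
  have YbX : b |: X = X :|: Y.
    apply/eqP; rewrite eqEcard bXsub // bX4 leqNgt; apply/negP => gt4.
    have : (5%:R : rat) <= #|X :|: Y|%:R by rewrite ler_nat.
    have := weight_faceU Xs Ys.
    have := @weight_ge _ _ _ _ (X :|: Y) [:: p; X; Y] zP.
    rewrite /= !inE eq_sym (negPf Xp) eq_sym (negPf Yp) XY pX // subsetUl subsetUr.
    by rewrite !big_cons big_nil => /(_ isT isT); lra.
  have : (4%:R : rat) <= #|X :|: Y'|%:R.
    by rewrite ler_nat -bX4 subset_leq_card // bXsub.
  have := weight_faceU Xs Y's.
  have := @weight_ge _ _ _ _ (X :|: Y') [:: p; X; Y; Y'] zP.
  have YXY' : Y \subset X :|: Y'.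
    by apply: subset_trans (bXsub _ bY'); rewrite YbX subsetUr.
  rewrite /= !inE !negb_or eq_sym Xp eq_sym Yp eq_sym Y'p XY XY' YY' pX // subsetUl subsetUr YXY'.
  by rewrite !big_cons big_nil => /(_ isT isT); lra.
have /eqP/cards2P[Y [Y' [YY' sb]]] : #|star b :\ p| = 2%N.
  by have := cardsD1 p (star b); rewrite sb3 pb => -[].
have [/(key Y Y' YY' sb)//|/ltW] := lerP (z Y') (z Y).
by apply: key; rewrite 1?eq_sym // setUC.
Qed.

(* A degree-2 vertex lies in a face of size at most 2, and such a face contains
   at most one degree-2 vertex; on the other hand the small support makes small
   faces rarer than degree-2 vertices.  Hence all the inequalities are tight. *)
Lemma irreducible_cubic :
  (forall e, e \in supp z -> #|e| = 3%N) /\ (forall v, v \in U -> #|star v| = 3%N).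
Proof.
pose S2 := [set e in supp z | #|e| == 2%N]; pose S1 := [set e in supp z | #|e| == 1%N].
pose small := [set e in supp z | (#|e| <= 2)%N].
pose U2 := [set v in U | #|star v| == 2%N]; pose U4 := [set v in U | (3 < #|star v|)%N].
pose sm v := [set e in small | v \in e].
pose B2 := [set v in U2 | (1 < #|sm v|)%N].
have sizes : (\sum_(e in supp z) #|e| + #|S2| + 2 * #|S1| = #|supp z| * 3)%N.
  rewrite !card_set_in big_distrr -!big_split -sum_nat_const /=.
  apply: eq_bigr => e /suppP[+ _ _ + _]; rewrite -cards_eq0.
  by case: #|e| => [|[|[|[|]]]].
have degs : (#|U| * 3 + #|U4| <= \sum_(v in U) #|star v| + #|U2|)%N.
  rewrite !card_set_in -sum_nat_const -!big_split /=; apply: leq_sum => v vU.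
  by have := star_deg vU; case: #|star v| => [|[|[|[|]]]] //= n; lia.
have sum_deg : \sum_(e in supp z) #|e| = \sum_(v in U) #|star v|.
  rewrite -sum_card_setI; apply: eq_bigr => e /suppP[_ eU _ _ _].
  by rewrite (setIidPl eU).
have sm_gt0 v : v \in U2 -> (0 < #|sm v|)%N.
  rewrite inE => /andP[vU /eqP s2]; have [p /starP[ps vp] p2] := deg2_small vU s2.
  have psm : p \in small by rewrite in_set ps.
  by apply/card_gt0P; exists p; rewrite in_set psm.
have smallU2 e : e \in small -> (#|e :&: U2| <= 1)%N.
  rewrite in_set => /andP[es e2]; rewrite leqNgt; apply/negP => gt1.
  have eU2 : e \subset U2.
    by apply/setIidPl/eqP; rewrite eqEcard subsetIl (leq_trans e2).
  have /cards2P[a [b [ab eE]]] : #|e| == 2%N.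
    by rewrite eqn_leq e2 (leq_trans gt1) // subset_leq_card // subsetIl.
  have /andP[_ /eqP da] : (a \in U) && (#|star a| == 2%N).
    by have := subsetP eU2 a; rewrite eE set21 in_set => ->.
  have /andP[_ /eqP db] : (b \in U) && (#|star b| == 2%N).
    by have := subsetP eU2 b; rewrite eE set22 in_set => ->.
  by have := pair_not_deg2 ab; rewrite -eE => /(_ es da); rewrite db.
have cardsm : #|small| = (#|S1| + #|S2|)%N.
  rewrite !card_set_in -big_split /=; apply: eq_bigr => e /suppP[+ _ _ + _].
  by rewrite -cards_eq0; case: #|e| => [|[|[|[|]]]].
have inc : (#|U2| + #|B2| <= #|small|)%N.
  apply: (@leq_trans (\sum_(v in U2) #|sm v|)).
    rewrite (card_set_in U2) -[#|U2|]muln1 -sum_nat_const -big_split /=.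
    by apply: leq_sum => v /sm_gt0; case: #|sm v| => [|[|]].
  by rewrite -sum_card_setI -[leqRHS]muln1 -sum_nat_const; apply: leq_sum.
(* Since [|supp z| <= |U|], [sizes] and [degs] give [|S2| + 2 |S1| + |U4| <= |U2|], while [inc]
   gives [|U2| + |B2| <= |S1| + |S2|]. Adding leaves [|S1| + |U4| + |B2| <= 0]. *)
have [S1_0 U4_0 B2_0 S2_0] :
    [/\ #|S1| = 0, #|U4| = 0, #|B2| = 0 & #|U2| = 0 -> #|S2| = 0]%N.
  move: z_small sizes degs sum_deg cardsm inc; clear.
  move: #|S1| #|U4| #|B2| #|supp z| #|U| #|S2| #|U2| #|small| => m1 m2 m3 m4 m5 m6 m7 m8.
  by move: (\sum_(e in supp z) _)%N (\sum_(v in U) _)%N => m9 m10; split; lia.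
have deg3 v : v \in U -> #|star v| != 2%N -> #|star v| = 3%N.
  move=> vU d2; apply/eqP; rewrite eqn_leq ltn_neqAle eq_sym d2 star_deg // !andbT.
  rewrite leqNgt; apply/negP => gt3.
  by move/eqP: U4_0; rewrite cards_eq0 => /eqP/setP/(_ v); rewrite !in_set vU gt3.
have size_ne1 e : e \in supp z -> #|e| != 1%N.
  move=> es; apply/negP => e1.
  by move/eqP: S1_0; rewrite cards_eq0 => /eqP/setP/(_ e); rewrite in_set es e1 inE.
(* A degree-2 vertex [a] would lie in a pair [{a, b}] and a triple; then [b] has degree neither 2
   nor 3, though only these remain. *)
have U2_0 : U2 = set0.
  apply/eqP; apply: contraT => /set0Pn[a aU2].
  have /andP[aU /eqP da] : (a \in U) && (#|star a| == 2%N) by move: aU2; rewrite in_set.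
  have /cards1P[p smE] : #|sm a| == 1%N.
    rewrite eqn_leq sm_gt0 // andbT leqNgt; apply/negP => gt1.
    by move/eqP: B2_0; rewrite cards_eq0 => /eqP/setP/(_ a); rewrite in_set aU2 gt1 inE.
  have : p \in sm a by rewrite smE set11.
  rewrite in_set => /andP[]; rewrite in_set => /andP[ps p2] ap.
  have /cards2P[x [y [xy pE]]] : #|p| == 2%N.
    by rewrite eqn_leq p2 ltn_neqAle eq_sym size_ne1 // card_gt0; case: (suppP ps).
  have [b ab pE'] : exists2 b, a != b & p = [set a; b].
    by move: ap; rewrite pE => /set2P[]->; [exists y | exists x; rewrite 1?eq_sym 1?setUC].
  have pa : p \in star a by rewrite in_star ps.
  have [X [Xp saE _]] := star_deg2 aU da pa.
  have Xa : X \in star a by rewrite saE set22.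
  have [Xs aX] := starP Xa.
  have X3 : #|X| = 3%N.
    have [_ _ _ X3 _] := suppP Xs; apply/eqP; rewrite eqn_leq X3 ltnNge.
    apply: contraNN Xp => X2; rewrite -in_set1 -smE in_set aX andbT.
    by rewrite in_set Xs.
  rewrite pE' in ps; have db := pair_not_deg2 ab ps da.
  have bU : b \in U by have [_ /subsetP-> //] := suppP ps; rewrite set22.
  by have := pair_not_deg3 ab ps da Xa X3; rewrite deg3.
split=> [e es|v vU]; last first.
  apply: deg3 => //; apply/negP => d2.
  by move/setP/(_ v): U2_0; rewrite in_set vU d2 inE.
have [e0 _ _ e3 _] := suppP es; apply/eqP; rewrite eqn_leq e3 /= ltn_neqAle.
rewrite ltn_neqAle (eq_sym 1%N) size_ne1 // card_gt0 e0 !andbT; apply/negP => /eqP e2.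
have /eqP := S2_0 (etrans (congr1 (fun A : {set V} => #|A|) U2_0) (cards0 V)).
by rewrite cards_eq0 => /eqP/setP/(_ e); rewrite in_set es -e2 inE.
Qed.

(** The support consists of triples, so [sum z = |U| / 3] and the target [sum z + |U| / 6] is the
    bound [|U| / 2] of [cubic_coverable]. *)
Lemma irreducible_coverable : exists2 k, coverable E U k &
  6 * k%:R <= 6 * (\sum_(e : {set V}) z e) + #|U|%:R.
Proof.
have [size3 deg3] := irreducible_cubic.
have [||k Uk lek] := @cubic_coverable _ E (supp z) U.
- by move=> e es; have [_ eU fe _ _] := suppP es; rewrite size3.
- exact: deg3.
exists k => //.
have sumU : 3 * (\sum_(e : {set V}) z e) = #|U|%:R.
  by apply: (fpart_uniform_total zP) => e ze; apply: size3; rewrite inE.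
have : (2 * k)%:R <= #|U|%:R :> rat by rewrite ler_nat.
by rewrite natrM; lra.
Qed.

End Irreducible.

(** * Induction on the number of vertices *)

Theorem rank3_coverable U z : fractional_partition E U z ->
  exists2 k, coverable E U k &
    6 * k%:R <= 6 * (\sum_(e : {set V}) z e) + #|U|%:R.
Proof.
have [n] := ubnP #|U|; elim: n U z => // n IHn U z0; rewrite ltnS => leUn z0P.
have [z [zP lez z_small]] := fpart_small_support z0P.
suff [k Uk lek] : exists2 k, coverable E U k &
    6 * k%:R <= 6 * (\sum_(e : {set V}) z e) + #|U|%:R.
  by exists k => //; lra.
(* Quantifying over covers [C] themselves rather than sizes [k] keeps this statement boolean. *)
pose reducible := [exists R : {set V}, exists C : {set {set V}},
  [&& R \subset U, R != set0, C \subset E, R \subset cover C &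
      #|C|%:R - #|R|%:R / 6 <= weight z R]].
have [|irr] := boolP reducible; last first.
  apply: irreducible_coverable z_small _ => // R k RU R0 [C [CE RC Ck]].
  rewrite ltNge; apply: contraNN irr => lew.
  apply/existsP; exists R; apply/existsP; exists C; rewrite RU R0 CE RC /=.
  by apply: le_trans lew; rewrite lerD2r ler_nat.
case/existsP=> R /existsP[C /and5P[RU R0 CE RC leC]].
have [z' z'P sumz'] := fpart_restrict R zP.
have cardUR : (#|U :\: R| = #|U| - #|R|)%N by rewrite cardsDS.
have leR := subset_leq_card RU.
have [|k Uk lek] := IHn _ _ _ z'P.
  by move: leUn leR; rewrite cardUR -card_gt0 in R0 *; lia.
exists (#|C| + k)%N.
  rewrite -(setID U R) (setIidPr RU); apply: coverableU => //.
  by exists C; rewrite CE RC.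
(* The edges of [C] are paid for by the weight lost: [6 |C| <= 6 weight z R + |R|]. *)
move: lek; rewrite sumz' cardUR natrB // natrD; lra.
Qed.

End RankThree.

(** * Regular 3-uniform hypergraphs *)

Theorem corollary1p4 (V : finType) (H : hypergraph V) (n : nat)
  (H_uniform : uniform H 3) (H_regular : regular H) (card_V : #|V| = n) :
  (rho H)%:R <= n%:R / 2 :> rat.
Proof.
have [v0 _] := card_gt0P (vertices_neq0 H).
pose z e : rat := if e \in edges H then (degree H v0)%:R^-1 else 0.
have z_edge e : z e != 0 -> e \in edges H by rewrite /z; case: ifP; rewrite ?eqxx.
have d_gt0 : (0 < degree H v0)%N.
  have : v0 \in cover (edges H) by rewrite edges_cover inE.
  by case/bigcupP=> e eE ve; apply/card_gt0P; exists e; rewrite inE eE.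
have zP : fractional_partition (edges H) [set: V] z.
  split=> [e|e /z_edge eE|v _].
  - by rewrite /z; case: ifP => // _; rewrite invr_ge0 ler0n.
  - split; [by apply: contraTneq eE => ->; exact: edges_neq0 | exact: subsetT |].
    by apply/existsP; exists e; rewrite eE subxx.
  - rewrite -big_mkcondr sumr_const.
    have -> : #|[pred e : {set V} | (v \in e) && (e \in edges H)]| = degree H v0.
      by rewrite -(H_regular v v0); apply: eq_card => e; rewrite !inE andbC.
    by rewrite -[X in X *+ _]mul1r -mulrnAr -mulr_natl mul1r mulfV // pnatr_eq0 -lt0n.
have rank3 e : e \in edges H -> (#|e| <= 3)%N by move/H_uniform->.
have [k [C [CE UC Ck]] lek] := rank3_coverable rank3 zP.
have := fpart_uniform_total zP (fun e ze => H_uniform _ (z_edge _ ze)).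
rewrite cardsT card_V in lek * => sumz.
have leC : (rho H <= #|C|)%N.
  by have [_ ->] := rhoP H; rewrite // /edge_cover CE -subTset.
(* [3 sum z = n] turns [6 k <= 6 sum z + n] into [6 k <= 3 n]. *)
by have := leq_trans leC Ck; rewrite -(ler_nat rat); lra.
Qed.
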